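(* Let $s>4$ and let $V$ be the set of $s^2$ treatments of a pseudo-$L_3(s)$ association scheme. Suppose: (I) for every treatment $x$, the $3(s-1)$ first associates of $x$ can be divided into three pairwise disjoint sets $Y=\{y_1,\dots,y_{s-1}\}$, $Z=\{z_1,\dots,z_{s-1}\}$, $W=\{w_1,\dots,w_{s-1}\}$ such that any two distinct treatments within $Y$, within $Z$, and within $W$ are first associates; (I') for every $y\in Y$ there is exactly one treatment in $Z$ and exactly one treatment in $W$ that is a first associate of $y$; for every $z\in Z$ there is exactly one treatment in $Y$ and exactly one in $W$ that is a first associate of $z$; for every $w\in W$ there is exactly one treatment in $Y$ and exactly one in $Z$ that is a first associate of $w$. Then there exist three partitions $\mathcal P_v=\{B^v_1,\dots,B^v_s\}$ ($v=1,2,3$) of $V$, each into $s$ pairwise disjoint sets in each of which any two distinct treatments are first associates, such that for any $v\neq u$ in $\{1,2,3\}$ and any $i',j'\in\{1,\dots,s\}$, $B^v_{i'}$ and $B^u_{j'}$ have exactly one common treatment.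
   Context: An association scheme with two associate classes on $v$ treatments is a symmetric relation splitting every pair of distinct treatments into first or second associates such that each treatment has $n_i$ $i$-th associates and for two $i$-th associates the number of treatments that are $j$-th associates of the first and $k$-th associates of the second is a constant $p^i_{jk}$. A pseudo-$L_3(s)$ association scheme is such a scheme with $v=s^2$, $n_1=3(s-1)$, $p^1_{11}=s$, $p^2_{11}=6$. *)

(* Defs.v *)
From mathcomp Require Import all_boot.

Set Implicit Arguments.
Unset Strict Implicit.
Unset Printing Implicit Defensive.

Variant assoc_class := First | Second.

(* A two-class scheme is given by its first-associate relation [e]; second
   associates are then the remaining pairs of distinct treatments. *)
Definition associates (T : finType) (e : rel T) (i : assoc_class) : rel T :=
  fun x y => match i with
             | First => e x y
             | Second => (x != y) && ~~ e x y
             end.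

(* [n i] is the parameter n_i and [p i j k] the parameter p^i_{jk}. *)
Record association_scheme (T : finType) (e : rel T) (v : nat)
    (n : assoc_class -> nat)
    (p : assoc_class -> assoc_class -> assoc_class -> nat) : Prop := {
  scheme_card : #|T| = v;
  scheme_irr : irreflexive e;
  scheme_sym : symmetric e;
  scheme_valency : forall i x, #|[set y | associates e i x y]| = n i;
  scheme_param : forall i j k x y, associates e i x y ->
    #|[set z | associates e j x z && associates e k y z]| = p i j k
}.

Definition pseudo_L3 (T : finType) (e : rel T) (s : nat) : Prop :=
  exists (n : assoc_class -> nat)
         (p : assoc_class -> assoc_class -> assoc_class -> nat),
    [/\ association_scheme e (s ^ 2) n p,
        n First = 3 * (s - 1),
        p First First First = s &
        p Second First First = 6].

Definition clique (T : finType) (e : rel T) (A : {set T}) : Prop :=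
  {in A &, forall a b, a != b -> e a b}.

Definition condition_I (T : finType) (e : rel T) (s : nat) (x : T)
    (Y Z W : {set T}) : Prop :=
  [/\ [set y | e x y] = Y :|: Z :|: W,
      [/\ #|Y| = s - 1, #|Z| = s - 1 & #|W| = s - 1],
      [/\ [disjoint Y & Z], [disjoint Y & W] & [disjoint Z & W]] &
      [/\ clique e Y, clique e Z & clique e W]].

Definition one_associate_in (T : finType) (e : rel T) (A B : {set T}) : Prop :=
  {in A, forall a, #|[set b in B | e a b]| = 1}.

Definition condition_I' (T : finType) (e : rel T) (Y Z W : {set T}) : Prop :=
  [/\ one_associate_in e Y Z /\ one_associate_in e Y W,
      one_associate_in e Z Y /\ one_associate_in e Z W &
      one_associate_in e W Y /\ one_associate_in e W Z].

(* Main.v *)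
(** The lines of the geometry are the cliques of size [s].  Since [s > 4], the
    conditions (I) and (I') force the lines through [x] to be exactly the three
    sets [x |: Y], [x |: Z], [x |: W], so two lines share at most one point.  A
    point [x] off a line [B] has either no or two first associates on [B]; there
    are [2 s (s - 1)] edges leaving [B] and [s (s - 1)] points off [B], so it is
    always two.  Hence two of the three lines through [x] meet [B] and exactly
    one misses it: being equal or disjoint is an equivalence relation on lines,
    and its three classes are the required partitions. *)
Require Import Defs.
From mathcomp Require Import all_boot.

Set Implicit Arguments.
Unset Strict Implicit.
Unset Printing Implicit Defensive.

(** * Neighbourhoods in indexed form, and lines *)

(** Indexing [Y], [Z], [W] by ['I_3] lets one argument treat all three sets at once. *)
Definition star (T : finType) (e : rel T) (s : nat) (x : T)
    (X : 'I_3 -> {set T}) : Prop :=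
  [/\ forall y, e x y = [exists i, y \in X i],
      forall i, #|X i| = s - 1,
      forall i, clique e (X i),
      forall i j, i != j -> [disjoint X i & X j] &
      forall i j, i != j -> one_associate_in e (X i) (X j)].

Lemma condition_star (T : finType) (e : rel T) (s : nat) (x : T)
    (Y Z W : {set T}) :
  condition_I e s x Y Z W -> condition_I' e Y Z W ->
  exists X, star e s x X.
Proof.
move=> [nbh [cY cZ cW] [dYZ dYW dZW] [kY kZ kW]] [[YZ YW] [ZY ZW] [WY WZ]].
exists (fun i : 'I_3 => nth set0 [:: Y; Z; W] i); split.
- move=> y; have /setP/(_ y) := nbh; rewrite !inE => ->.
  apply/idP/existsP.
    by case/orP=> [/orP[]|] yX;
      [exists (@Ordinal 3 0 isT)|exists (@Ordinal 3 1 isT)|exists (@Ordinal 3 2 isT)].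
  by case=> [[[|[|[|]]]]] //= _ ->; rewrite ?orbT.
- by case=> [[|[|[|]]]].
- by case=> [[|[|[|]]]].
- by case=> [[|[|[|]]]] //= ? [[|[|[|]]]] //= ? _; rewrite // disjoint_sym.
- by case=> [[|[|[|]]]] //= ? [[|[|[|]]]].
Qed.

Lemma third_index (i j : 'I_3) :
  i != j -> exists k, forall m, (m == k) = (m != i) && (m != j).
Proof.
move=> ij; have : #|~: [set i; j]| == 1.
  by rewrite cardsCs setCK cards2 ij card_ord.
by case/cards1P=> k /setP kP; exists k => m; have := kP m; rewrite !inE negb_or.
Qed.

(** The clique condition is boolean here so that the lines form a finite set; [linesP] recovers
    [clique]. *)
Definition lines (T : finType) (e : rel T) (s : nat) : {set {set T}} :=
  [set B : {set T} | [forall a in B, forall b in B, (a != b) ==> e a b]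
                     && (#|B| == s)].

Lemma linesP (T : finType) (e : rel T) (s : nat) (B : {set T}) :
  reflect (clique e B /\ #|B| = s) (B \in lines e s).
Proof.
rewrite inE; apply: (iffP andP) => -[h /eqP cB]; split=> //.
- move=> a b aB bB ab.
  by have /forall_inP/(_ a aB)/forall_inP/(_ b bB)/implyP := h; apply.
- apply/forall_inP=> a aB; apply/forall_inP=> b bB; apply/implyP; exact: h.
Qed.

Definition parallel_class (T : finType) (e : rel T) (s : nat) (L : {set T}) :
    {set {set T}} :=
  [set M in lines e s | (M == L) || [disjoint M & L]].

Section Geometry.

Context (T : finType) (e : rel T) (s : nat).
Hypotheses (irr : irreflexive e) (sym : symmetric e) (hs : 4 < s).
Hypotheses (cardT : #|T| = s ^ 2).
Hypothesis valency : forall x, #|[set y | e x y]| = 3 * (s - 1).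
Hypothesis starE : forall x, exists X, star e s x X.

Local Notation lines := (lines e s).
Local Notation parallel_class := (parallel_class e s).

(** * Lines through a point *)

Lemma star_adj x X i y : star e s x X -> y \in X i -> e x y.
Proof. by case=> h _ _ _ _ yX; rewrite h; apply/existsP; exists i. Qed.

Lemma star_center x X i : star e s x X -> x \notin X i.
Proof. by move=> sX; apply/negP => /(star_adj sX); rewrite irr. Qed.

Lemma star_index x X i j y :
  star e s x X -> y \in X i -> y \in X j -> i = j.
Proof.
case=> _ _ _ dX _ yi yj; apply/eqP/negPn/negP => /dX.
by rewrite disjoint_subset => /subsetP/(_ y yi); rewrite inE yj.
Qed.

Lemma star_line x X i : star e s x X -> x |: X i \in lines.
Proof.
move=> sX; have [adj cX kX _ _] := sX; apply/linesP; split; last first.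
  by rewrite cardsU1 (star_center _ sX) cX add1n subn1 prednK // (ltn_trans _ hs).
move=> a b /setU1P[->|aX] /setU1P[->|bX]; rewrite ?eqxx // => ab.
- exact: star_adj bX.
- by rewrite sym (star_adj sX aX).
- exact: (kX i) ab.
Qed.

(** If [B :\ x] met two of the sets [X i], condition (I') would leave it at most one point in each
    of the three, against [3 < s - 1]. *)
Lemma line_star x X B :
  star e s x X -> B \in lines -> x \in B -> exists i, B = x |: X i.
Proof.
move=> sX /linesP[kB cB] xB; have [adj cX kX dX oX] := sX.
have cBx : #|B :\ x| = s - 1 by rewrite -cB (cardsD1 x B) xB add1n subn1.
have inX y : y \in B :\ x -> exists i, y \in X i.
  case/setD1P=> yx yB; apply/existsP; rewrite -adj.
  by apply: kB => //; rewrite eq_sym.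
have s1 : 3 < s - 1 by rewrite ltn_subRL.
have [y yB] : exists y, y \in B :\ x.
  by apply/card_gt0P; rewrite cBx (leq_trans _ s1).
have [i yi] := inX y yB.
have [sub|/subsetPn[z zB zi]] := boolP (B :\ x \subset X i).
  exists i; rewrite -(setD1K xB); congr (_ |: _).
  by apply/eqP; rewrite eqEcard sub cX cBx leqnn.
have [j zj] := inX z zB.
have ij : i != j by apply: contraNneq zi => ->.
have le1 k : #|(B :\ x) :&: X k| <= 1.
  (* Since [y] and [z] lie in different sets, one of them lies outside [X k]. All points of [B] in
     [X k] are associates of that point, which has only one associate in [X k]. *)
  have [m [u [mk uB um]]] : exists m u, [/\ m != k, u \in B :\ x & u \in X m].
    have [ik|ik] := eqVneq i k; last by exists i, y.
    by exists j, z; rewrite -ik eq_sym.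
  rewrite -(oX _ _ mk u um); apply/subset_leq_card/subsetP=> b.
  case/setIP=> bB bk; rewrite inE bk /=.
  have [/setD1P[_ uB'] /setD1P[_ bB']] := (uB, bB).
  apply: kB => //; apply: contra mk => /eqP ub.
  by apply/eqP; apply: (star_index sX um); rewrite ub.
suff : #|B :\ x| <= 3 by rewrite cBx leqNgt s1.
have -> : B :\ x = \bigcup_k ((B :\ x) :&: X k).
  apply/setP=> b; apply/idP/bigcupP=> [bB|[k _ /setIP[] //]].
  by have [k bk] := inX b bB; exists k => //; apply/setIP.
apply: (@leq_trans (\sum_(k < 3) 1)); last by rewrite sum1_card card_ord.
elim/big_ind2: _ => [|A m C n leA leC|//]; first by rewrite cards0.
by rewrite (leq_trans (leq_card_setU _ _)) // leq_add.
Qed.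

Lemma line_inj B C x y :
  B \in lines -> C \in lines -> x != y ->
  x \in B -> y \in B -> x \in C -> y \in C -> B = C.
Proof.
move=> lB lC xy xB yB xC yC; have [X sX] := starE x.
have [i Bi] := line_star sX lB xB; have [j Cj] := line_star sX lC xC.
move: yB yC; rewrite Bi Cj !inE eq_sym (negbTE xy) /= => yi yj.
by rewrite (star_index sX yi yj).
Qed.

(** * Counting first associates on a line *)

(** Seen from an associate [a] of [x] on [B], the rest of [B] is one set [X i] and [x] lies in
    another, so (I') gives exactly one further associate besides [a]. *)
Lemma line_adj0_2 B x :
  B \in lines -> x \notin B ->
  #|[set b in B | e x b]| = 0 \/ #|[set b in B | e x b]| = 2.
Proof.
move=> lB xB; have [->|[a]] := set_0Vmem [set b in B | e x b].
  by left; rewrite cards0.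
rewrite inE => /andP[aB xa]; right.
have [X sX] := starE a; have [adj _ _ _ oX] := sX.
have [i Bi] := line_star sX lB aB.
have /existsP[j xj] : [exists j, x \in X j] by rewrite -adj sym.
have ji : j != i.
  by apply: contraNneq xB => ji; rewrite Bi -ji inE xj orbT.
have -> : [set b in B | e x b] = a |: [set b in X i | e x b].
  apply/setP=> b; rewrite Bi !inE; case: eqP => [->|] //=.
by rewrite cardsU1 (oX _ _ ji x xj) inE (negbTE (star_center i sX)).
Qed.

Lemma card_off_line_adj B b :
  B \in lines -> b \in B -> #|[set x in ~: B | e x b]| = 2 * (s - 1).
Proof.
move=> /linesP[kB cB] bB.
have -> : [set x in ~: B | e x b] = [set y | e b y] :\: B.
  by apply/setP=> x; rewrite !inE sym.
rewrite cardsD valency.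
have -> : [set y | e b y] :&: B = B :\ b.
  apply/setP=> y; rewrite !inE; apply/andP/andP=> [[by_ yB]|[yb yB]]; split=> //.
    by apply: contraTneq by_ => ->; rewrite irr.
  by apply: kB => //; rewrite eq_sym.
have -> : #|B :\ b| = s - 1 by rewrite -cB (cardsD1 b B) bB add1n subn1.
by rewrite mulSn addKn.
Qed.

Lemma line_adj2 B x :
  B \in lines -> x \notin B -> #|[set b in B | e x b]| = 2.
Proof.
move=> lB xB; have /linesP[_ cB] := lB.
(* Recording the equality case lets equal sums force every term to be 2. *)
have le2 y : y \in ~: B -> #|[set b in B | e y b]| <= 2 ?= iff
    (#|[set b in B | e y b]| == 2).
  by rewrite inE => yB; split=> //; case: (line_adj0_2 lB yB) => ->.
(* Double count of the edges leaving [B]: [s] points with [2 * (s - 1)] edges each, against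
   [s ^ 2 - s] points off [B]. *)
have tot : \sum_(y in ~: B) #|[set b in B | e y b]| = \sum_(y in ~: B) 2.
  have sumE : \sum_(y in ~: B) #|[set b in B | e y b]| =
      \sum_(y in ~: B) \sum_(b in B) (e y b : nat).
    apply: eq_bigr => y _; rewrite -sum1_card -big_mkcondr /=.
    by apply: eq_bigl => b; rewrite inE.
  rewrite {}sumE exchange_big /=.
  rewrite (eq_bigr (fun=> 2 * (s - 1))) => [|b bB]; last first.
    rewrite -(card_off_line_adj lB bB) -sum1_card -big_mkcondr /=.
    by apply: eq_bigl => y; rewrite inE.
  rewrite !sum_nat_const cB cardsCs setCK cardT cB mulnCA mulnC.
  by rewrite mulnBr muln1 -mulnn.
have [_] := leqif_sum le2; rewrite tot eqxx => /esym/forall_inP/(_ x).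
by rewrite inE xB => /(_ isT)/eqP.
Qed.

(** The two associates of [x] on [B] lie in different sets of the star of [x], since otherwise [B]
    would be a line through [x]. The third set yields the only line through [x] missing [B]. *)
Lemma parallel_through B x :
  B \in lines -> x \notin B ->
  exists C, forall D,
    [/\ D \in lines, x \in D & [disjoint D & B]] <-> D = C.
Proof.
move=> lB xB; have [X sX] := starE x; have [adj _ _ _ _] := sX.
have /eqP/cards2P[b1 [b2 [b12 /setP nbB]]] := line_adj2 lB xB.
have [/andP[b1B xb1] /andP[b2B xb2]] :
    ((b1 \in B) && e x b1) /\ ((b2 \in B) && e x b2).
  by have := (nbB b1, nbB b2); rewrite !inE !eqxx orbT /= => -[-> ->].
have [/existsP[i b1i] /existsP[j b2j]] :
    [exists i, b1 \in X i] /\ [exists i, b2 \in X i] by rewrite -!adj.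
have ij : i != j.
  apply: contraNneq xB => ij.
  have -> : B = x |: X i.
    by apply: (line_inj lB (star_line i sX) b12) => //; rewrite inE ?b1i ?ij ?b2j orbT.
  exact: setU11.
have [k kP] := third_index ij; exists (x |: X k) => D; split.
- case=> lD xD DB; have [m Dm] := line_star sX lD xD.
  rewrite Dm; congr (_ |: X _); apply/eqP; rewrite kP.
  apply/andP; split; apply: contraTneq DB => mE; rewrite Dm mE.
  + by apply/pred0Pn; exists b1; rewrite /= inE b1i orbT.
  + by apply/pred0Pn; exists b2; rewrite /= inE b2j orbT.
- move=> ->; split; [exact: star_line|exact: setU11|].
  (* A point of [X k] on [B] would be an associate of [x], hence [b1] or [b2], which lie in other
     sets. *)
  apply/pred0P=> b /=; apply/negP=> /andP[/setU1P[->|bk] bB].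
    by rewrite (negbTE xB) in bB.
  have := nbB b; rewrite !inE bB (star_adj sX bk) /=.
  have := kP k; rewrite eqxx => /esym/andP[ki kj] /esym/orP[]/eqP bE.
    by case/eqP: ki; apply: (star_index sX bk); rewrite bE.
  by case/eqP: kj; apply: (star_index sX bk); rewrite bE.
Qed.

(** * Parallelism and its classes *)

Lemma parallel_class_refl L : L \in lines -> L \in parallel_class L.
Proof. by move=> lL; rewrite inE lL eqxx. Qed.

Lemma parallel_class_sym L M :
  L \in lines -> M \in parallel_class L -> L \in parallel_class M.
Proof. by move=> lL /setIdP[lM ML]; rewrite inE lL eq_sym disjoint_sym. Qed.

Lemma parallel_class_cover L x :
  L \in lines -> exists2 M, M \in parallel_class L & x \in M.
Proof.
move=> lL; have [xL|xL] := boolP (x \in L).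
  by exists L => //; apply: parallel_class_refl.
have [C CP] := parallel_through lL xL; have [lC xC CL] := (CP C).2 erefl.
by exists C => //; rewrite inE lC CL orbT.
Qed.

Lemma parallel_class_inj L M N x :
  L \in lines -> M \in parallel_class L -> N \in parallel_class L ->
  x \in M -> x \in N -> M = N.
Proof.
move=> lL /setIdP[lM ML] /setIdP[lN NL] xM xN.
have [xL|xL] := boolP (x \in L).
  have meetL (K : {set T}) : x \in K -> (K == L) || [disjoint K & L] -> K = L.
    move=> xK /orP[/eqP //|/disjoint_setI0/setP/(_ x)].
    by rewrite !inE xK xL.
  by rewrite (meetL M) // (meetL N).
have [C CP] := parallel_through lL xL.
have missL K : K \in lines -> x \in K -> (K == L) || [disjoint K & L] -> K = C.
  move=> lK xK /orP[/eqP KL|KL]; last exact/CP.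
  by rewrite -KL xK in xL.
by rewrite (missL M) // (missL N).
Qed.

(** If [N] meets [L], then both belong to the class of [M] and share a point, so they coincide. *)
Lemma parallel_class_trans L M N :
  L \in lines -> M \in parallel_class L -> N \in parallel_class M ->
  N \in parallel_class L.
Proof.
move=> lL ML NM; have /setIdP[lM _] := ML; have /setIdP[lN _] := NM.
rewrite inE lN; have [//|/pred0Pn[x /andP[xN xL]]] := boolP [disjoint N & L].
  by rewrite orbT.
by rewrite (parallel_class_inj lM NM (parallel_class_sym lL ML) xN xL) eqxx.
Qed.

Lemma parallel_class_partition L :
  L \in lines -> partition (parallel_class L) [set: T].
Proof.
move=> lL; apply/and3P; split.
- rewrite eqEsubset subsetT; apply/subsetP=> x _; apply/bigcupP.
  exact: parallel_class_cover.
- apply/trivIsetP=> M N ML NL MN; rewrite -setI_eq0; apply/eqP/setP=> x.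
  rewrite !inE; apply: contraNF MN => /andP[xM xN].
  by apply/eqP; apply: (parallel_class_inj lL ML NL xM xN).
- apply/negP=> /setIdP[/linesP[_]]; rewrite cards0 => s0.
  by have := hs; rewrite -s0.
Qed.

Lemma card_parallel_class L : L \in lines -> #|parallel_class L| = s.
Proof.
move=> lL; have := card_uniform_partition _ (parallel_class_partition lL).
move=> /(_ s); rewrite cardsT cardT -mulnn => H; apply/eqP.
rewrite -(@eqn_pmul2r s) ?(ltn_trans _ hs) // -H //.
by move=> M /setIdP[/linesP[]].
Qed.

(** Were [M] and [N] parallel, transitivity would make [L] and [L'] parallel, hence equal as they
    share [x]. So [M] and [N] meet, and [line_inj] rules out a second common point. *)
Lemma parallel_class_meet L L' M N x :
  L \in lines -> L' \in lines -> L != L' -> x \in L -> x \in L' ->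
  M \in parallel_class L -> N \in parallel_class L' -> #|M :&: N| = 1.
Proof.
move=> lL lL' LL' xL xL' ML NL'.
have /setIdP[lM _] := ML; have /setIdP[lN _] := NL'.
have NM : N \notin parallel_class M.
  apply: contraNN LL' => NM; have NL := parallel_class_trans lL ML NM.
  have L'L := parallel_class_trans lL NL (parallel_class_sym lL' NL').
  by apply/eqP; apply: (parallel_class_inj lL (parallel_class_refl lL) L'L xL xL').
move: NM; rewrite inE lN negb_or => /andP[NM /pred0Pn[a /andP[aN aM]]].
apply/eqP/cards1P; exists a; apply/setP=> b; rewrite !inE.
apply/andP/eqP=> [[bM bN]|-> //]; apply/eqP; apply: contraNT NM => ba.
by rewrite (line_inj lN lM ba).
Qed.

End Geometry.

Theorem theorem3p8 (T : finType) (e : rel T) (s : nat)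
    (hs : 4 < s) (hL : pseudo_L3 e s)
    (hI : forall x : T, exists Y Z W : {set T},
        condition_I e s x Y Z W /\ condition_I' e Y Z W) :
  exists P : 'I_3 -> {set {set T}},
    (forall v : 'I_3,
        [/\ partition (P v) [set: T],
            #|P v| = s &
            forall B : {set T}, B \in P v -> clique e B]) /\
    (forall u v : 'I_3, v != u ->
        forall B C : {set T}, B \in P v -> C \in P u -> #|B :&: C| = 1).
Proof.
have [n [p [[cardT irr sym val _] n1 _ _]]] := hL.
have valency x : #|[set y | e x y]| = 3 * (s - 1) by rewrite -n1 -(val First x).
have starE x : exists X, star e s x X.
  by have [Y [Z [W [cI cI']]]] := hI x; apply: condition_star cI cI'.
(* The three partitions are the parallel classes of the three lines through an arbitrary point
   [x0]. *)
have [x0 _] : exists x0 : T, x0 \in T.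
  by apply/card_gt0P; rewrite cardT expn_gt0 (ltn_trans _ hs).
have [X sX] := starE x0.
have lX i := star_line irr sym hs i sX.
exists (fun i => parallel_class e s (x0 |: X i)); split=> [v|u v vu B C].
  split.
  - exact: parallel_class_partition.
  - exact: card_parallel_class.
  - by move=> B /setIdP[/linesP[]].
apply: (parallel_class_meet irr sym hs cardT valency starE (lX v) (lX u)) (setU11 _ _) (setU11 _ _).
(* A point of [X v] shows that the lines for [u] and [v] differ, which [parallel_class_meet]
   requires. *)
have [y yv] : exists y, y \in X v.
  have [_ cX _ _ _] := sX.
  by apply/card_gt0P; rewrite cX subn_gt0 (ltn_trans _ hs).
apply: contraNneq vu => /setP/(_ y); rewrite !inE yv orbT => /esym/orP[/eqP y0|yu].
  by rewrite y0 (negbTE (star_center irr v sX)) in yv.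
by rewrite (star_index sX yv yu).
Qed.
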